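(* Let $(\Gamma,\psi)$ be a $U(\mathbb{H})$-gain graph and let $\alpha=\{C_0,C_1,\ldots,C_k\}$ be a quaternionic GM partition of $V_\Gamma$. Then $(\Gamma,\psi)$ and $(\Gamma,\psi)^{\alpha,\mathbb{H}}$ are right cospectral.
   Context: **Quaternions and right spectrum.** $\mathbb{H}$ is the algebra of real quaternions, with conjugation $q\mapsto\overline q$ and norm $|q|$; $U(\mathbb{H})=\{q\in\mathbb{H}:|q|=1\}$ is the multiplicative group of unit quaternions. For $A=(a_{ij})\in M_n(\mathbb{H})$, $A^*=(\overline{a_{ji}})$; $A$ is Hermitian if $A=A^*$ and unitary if $AA^*=A^*A=I$. By the quaternionic spectral theorem, for a Hermitian $A\in M_n(\mathbb{H})$ there are a unitary $U\in M_n(\mathbb{H})$ and a real diagonal matrix $D$ with $U^*AU=D$; the right spectrum $\sigma_r(A)$ is the multiset of diagonal entries of $D$. Two Hermitian matrices are right cospectral if they have the same right spectrum (equivalently, if they are conjugate via a unitary matrix of $M_n(\mathbb{H})$). **Gain graphs.** $\Gamma=(V_\Gamma,E_\Gamma)$ is a finite simple graph; $u\sim v$ means $u,v$ are adjacent. A $U(\mathbb{H})$-gain graph $(\Gamma,\psi)$ consists of $\Gamma$ and a map $\psi$ from ordered pairs of adjacent vertices to $U(\mathbb{H})$ with $\psi(u,v)=\psi(v,u)^{-1}$. Fixing an ordering $v_1,\dots,v_n$ of $V_\Gamma$, its adjacency matrix is the Hermitian matrix in $M_n(\mathbb{H})$ whose $(i,j)$ entry is $\psi(v_i,v_j)$ if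 $v_i\sim v_j$ and $0$ otherwise. Two $U(\mathbb{H})$-gain graphs are right cospectral if their adjacency matrices are. **Quaternionic GM partition.** For a partition $\alpha=\{C_0,C_1,\dots,C_k\}$ of $V_\Gamma$ and $v\in V_\Gamma$, put $\Psi_i^{\mathbb{H}}(v)=\sum_{w\in C_i,\,w\sim v}\psi(v,w)$, the sum being taken in $\mathbb{H}$. $\alpha$ is a quaternionic GM partition if: - for all $i,j\in\{1,\dots,k\}$ and all $v,v'\in C_i$, $\Psi_j^{\mathbb{H}}(v)=\Psi_j^{\mathbb{H}}(v')$; - for every $v\in C_0$ and every $i\in\{1,\dots,k\}$, at least one of the following holds: (1) there exist $q_1,q_2\in U(\mathbb{H})\cup\{0\}$ such that $v$ is adjacent to half of the vertices of $C_i$ with gain $q_1$ and to the other half with gain $q_2$ (a zero gain meaning no adjacency; $q_1=q_2$ is allowed, meaning that $\psi(v,w)=q_1$ for all $w\in C_i$); (2) $\Psi_i^{\mathbb{H}}(v)=0$. **Switched graph.** $(\Gamma,\psi)^{\alpha,\mathbb{H}}=(\Gamma^{\alpha,\mathbb{H}},\psi^{\alpha,\mathbb{H}})$ is the $U(\mathbb{H})$-gain graph on the same vertex set such that: - adjacencies and gains between pairs of vertices of $\bigcup_{i=1}^k C_i$, and between pairs of vertices of $C_0$, are the same as in $(\Gamma,\psi)$; - for $v\in C_0$ and $i\in\{1,\dots,k\}$: if (1) holds, then for $w\in C_i$ one sets $\psi^{\alpha,\mathbb{H}}(v,w)=q_1$ if $\psi(v,w)=q_2$ and $\psi^{\alpha,\mathbb{H}}(v,w)=q_2$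 if $\psi(v,w)=q_1$, with the convention that the value $0$ means the two vertices are not adjacent; if (1) does not hold (so (2) holds), then adjacencies between $v$ and $C_i$ are unchanged and $\psi^{\alpha,\mathbb{H}}(v,w)=-\psi(v,w)$ for $w\in C_i$, $w\sim v$. In all cases $\psi^{\alpha,\mathbb{H}}(w,v)=\psi^{\alpha,\mathbb{H}}(v,w)^{-1}$. *)

(* Defs.v *)
From HB Require Import structures.
(* Imported first, so that [set0], [partition], [pblock] are those of finset. *)
From mathcomp Require Import boolp classical_sets reals.
From mathcomp Require Import all_boot all_order all_algebra.
From mathcomp Require Import ring.

Set Implicit Arguments.
Unset Strict Implicit.
Unset Printing Implicit Defensive.

Import Order.TTheory GRing.Theory Num.Theory.
Local Open Scope ring_scope.

(* [Quat a b c d] is a + b i + c j + d k. *)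
Record quat (R : realType) := Quat { qre : R; qi : R; qj : R; qk : R }.

Section QuatTheory.
Variable R : realType.
Implicit Types x y z : quat R.

Definition tuple_of_quat x := (qre x, qi x, qj x, qk x).
Definition quat_of_tuple (t : R * R * R * R) :=
  Quat t.1.1.1 t.1.1.2 t.1.2 t.2.

Lemma tuple_of_quatK : cancel tuple_of_quat quat_of_tuple.
Proof. by case. Qed.

HB.instance Definition _ := Choice.copy (quat R) (can_type tuple_of_quatK).

Definition quat_zero : quat R := Quat 0 0 0 0.
Definition quat_one : quat R := Quat 1 0 0 0.
Definition quat_opp x := Quat (- qre x) (- qi x) (- qj x) (- qk x).
Definition quat_add x y :=
  Quat (qre x + qre y) (qi x + qi y) (qj x + qj y) (qk x + qk y).
Definition quat_mul x y :=
  Quat (qre x * qre y - qi x * qi y - qj x * qj y - qk x * qk y)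
       (qre x * qi y + qi x * qre y + qj x * qk y - qk x * qj y)
       (qre x * qj y - qi x * qk y + qj x * qre y + qk x * qi y)
       (qre x * qk y + qi x * qj y - qj x * qi y + qk x * qre y).

Lemma quat_addA : associative quat_add.
Proof. by move=> [? ? ? ?] [? ? ? ?] [? ? ? ?]; congr Quat; rewrite /= addrA. Qed.
Lemma quat_addC : commutative quat_add.
Proof. by move=> [? ? ? ?] [? ? ? ?]; congr Quat; rewrite /= addrC. Qed.
Lemma quat_add0 : left_id quat_zero quat_add.
Proof. by move=> [? ? ? ?]; congr Quat; rewrite /= add0r. Qed.
Lemma quat_addN : left_inverse quat_zero quat_opp quat_add.
Proof. by move=> [? ? ? ?]; congr Quat; rewrite /= addNr. Qed.

HB.instance Definition _ :=
  GRing.isZmodule.Build (quat R) quat_addA quat_addC quat_add0 quat_addN.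

Lemma quat_mulA : associative quat_mul.
Proof. by move=> [? ? ? ?] [? ? ? ?] [? ? ? ?]; congr Quat => /=; ring. Qed.
Lemma quat_mul1q : left_id quat_one quat_mul.
Proof. by move=> [? ? ? ?]; congr Quat => /=; ring. Qed.
Lemma quat_mulq1 : right_id quat_one quat_mul.
Proof. by move=> [? ? ? ?]; congr Quat => /=; ring. Qed.
Lemma quat_mulDl : left_distributive quat_mul +%R.
Proof. by move=> [? ? ? ?] [? ? ? ?] [? ? ? ?]; congr Quat => /=; ring. Qed.
Lemma quat_mulDr : right_distributive quat_mul +%R.
Proof. by move=> [? ? ? ?] [? ? ? ?] [? ? ? ?]; congr Quat => /=; ring. Qed.
Lemma quat_one_neq0 : quat_one != 0.
Proof. by apply/eqP => -[] /eqP; rewrite oner_eq0. Qed.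

HB.instance Definition _ := GRing.Zmodule_isNzRing.Build (quat R)
  quat_mulA quat_mul1q quat_mulq1 quat_mulDl quat_mulDr quat_one_neq0.

Definition quat_real (a : R) : quat R := Quat a 0 0 0.
Definition qconj x := Quat (qre x) (- qi x) (- qj x) (- qk x).
Definition qsqnorm x : R := qre x ^+ 2 + qi x ^+ 2 + qj x ^+ 2 + qk x ^+ 2.
Definition qnorm x : R := Num.sqrt (qsqnorm x).

Lemma qsqnorm_ge0 x : 0 <= qsqnorm x.
Proof. by rewrite !addr_ge0 ?sqr_ge0. Qed.

Lemma qsqnorm_eq0 x : (qsqnorm x == 0) = (x == 0).
Proof.
apply/idP/eqP => [|->]; last by rewrite /qsqnorm /= expr0n !addr0.
case: x => a b c d; rewrite /qsqnorm /=.
rewrite !paddr_eq0 ?addr_ge0 ?sqr_ge0 // !sqrf_eq0.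
by move=> /andP[/andP[/andP[/eqP-> /eqP->] /eqP->] /eqP->].
Qed.

Lemma mulq_conj x : x * qconj x = quat_real (qsqnorm x).
Proof. by case: x => a b c d; congr Quat; rewrite /qsqnorm /=; ring. Qed.

Lemma mulconj_q x : qconj x * x = quat_real (qsqnorm x).
Proof. by case: x => a b c d; congr Quat; rewrite /qsqnorm /=; ring. Qed.

Definition quat_unit : pred (quat R) := fun x => x != 0.
Definition quat_inv x := quat_real (qsqnorm x)^-1 * qconj x.

Lemma quat_realM a b : quat_real a * quat_real b = quat_real (a * b).
Proof. by congr Quat => /=; ring. Qed.
Lemma quat_realC a x : quat_real a * x = x * quat_real a.
Proof. by case: x => *; congr Quat => /=; ring. Qed.

Lemma quat_mulVq : {in quat_unit, left_inverse 1 quat_inv *%R}.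
Proof.
move=> x x0; rewrite /quat_inv -mulrA mulconj_q quat_realM mulVf //.
by rewrite qsqnorm_eq0.
Qed.
Lemma quat_mulqV : {in quat_unit, right_inverse 1 quat_inv *%R}.
Proof.
move=> x x0; rewrite /quat_inv quat_realC mulrA mulq_conj quat_realM mulfV //.
by rewrite qsqnorm_eq0.
Qed.
Lemma quat_unitP x y : y * x = 1 /\ x * y = 1 -> quat_unit x.
Proof.
by move=> [yx _]; apply/eqP => x0; move: yx; rewrite x0 mulr0 => /esym/eqP; rewrite oner_eq0.
Qed.
Lemma quat_inv_out : {in [predC quat_unit], quat_inv =1 id}.
Proof.
move=> x /negPn/eqP ->; rewrite /quat_inv.
by congr Quat => /=; ring.
Qed.

HB.instance Definition _ := GRing.NzRing_hasMulInverse.Build (quat R)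
  quat_mulVq quat_mulqV quat_unitP quat_inv_out.

Lemma qnorm_eq1 x : (qnorm x == 1) = (qsqnorm x == 1).
Proof.
rewrite /qnorm -[in LHS](sqrtr1 R).
by rewrite -[X in _ = (X == _)]sqr_sqrtr ?qsqnorm_ge0 // sqrtr1 sqrp_eq1 ?sqrtr_ge0.
Qed.

Lemma qnorm1_neq0 x : qnorm x = 1 -> x != 0.
Proof.
by move/eqP; rewrite qnorm_eq1 -qsqnorm_eq0 => /eqP->; rewrite oner_eq0.
Qed.

Lemma qnorm1_inv x : qnorm x = 1 -> x^-1 = qconj x.
Proof.
move/eqP; rewrite qnorm_eq1 => /eqP x1.
by rewrite [LHS]/(quat_inv x) /quat_inv x1 invr1 (_ : quat_real 1 = 1) ?mul1r.
Qed.

Lemma qnorm_conj x : qnorm (qconj x) = qnorm x.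
Proof. by rewrite /qnorm /qsqnorm /= !sqrrN. Qed.

Lemma qnormN x : qnorm (- x) = qnorm x.
Proof. by rewrite /qnorm /qsqnorm /= !sqrrN. Qed.

End QuatTheory.

Section RightSpectrum.
Variables (R : realType) (n : nat).
Implicit Types A B U : 'M[quat R]_n.

Definition qadjoint A : 'M[quat R]_n := map_mx (@qconj R) A^T.

Definition qhermitian A : Prop := A = qadjoint A.

Definition qunitary U : Prop := U *m qadjoint U = 1%:M /\ qadjoint U *m U = 1%:M.

(* A multiset of reals is a sequence up to permutation; by the quaternionic
   spectral theorem a Hermitian matrix has exactly one right spectrum. *)
Definition is_right_spectrum A (s : seq R) : Prop :=
  exists (U : 'M[quat R]_n) (d : 'rV[R]_n),
    [/\ qunitary U,
        qadjoint U *m A *m U = diag_mx (map_mx (@quat_real R) d)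
      & perm_eq s [seq d 0 i | i <- enum 'I_n]].

Definition right_cospectral A B : Prop :=
  exists2 s : seq R, is_right_spectrum A s & is_right_spectrum B s.

End RightSpectrum.

(* The values of [gain] on non-adjacent pairs are irrelevant. *)
Record gain_graph (R : realType) (V : finType) := GainGraph {
  adj : rel V;
  gain : V -> V -> quat R;
  adj_sym : symmetric adj;
  adj_irr : irreflexive adj;
  gain_norm : forall u v, adj u v -> qnorm (gain u v) = 1;
  gain_inv : forall u v, adj u v -> gain u v = (gain v u)^-1
}.

Section GainGraphs.
Variables (R : realType) (V : finType).
Implicit Types (G : gain_graph R V) (C : {set V}) (alpha : {set {set V}}).
Implicit Types (u v w : V) (q : quat R).

(* The gain extended by 0 ("no adjacency"). *)
Definition gain0 G u v : quat R := if adj G u v then gain G u v else 0.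

(* The vertices are ordered by [enum]. *)
Definition adjacency G : 'M[quat R]_#|V| :=
  \matrix_(i, j) gain0 G (enum_val i) (enum_val j).

Definition graph_right_cospectral G G' : Prop :=
  right_cospectral (adjacency G) (adjacency G').

Definition gain_sum G C v : quat R := \sum_(w in C | adj G v w) gain G v w.

Definition unit_or_zero q : Prop := q = 0 \/ qnorm q = 1.

Definition half_half G C v q1 q2 : Prop :=
  [/\ unit_or_zero q1, unit_or_zero q2
    & (q1 = q2 /\ forall w, w \in C -> gain0 G v w = q1) \/
      [/\ q1 <> q2, (#|[set w in C | gain0 G v w == q1]|.*2 = #|C|)%N
        & (#|[set w in C | gain0 G v w == q2]|.*2 = #|C|)%N]].

(* The partition {C_0, C_1, ..., C_k} is given by the set C_0 and the set
   alpha = {C_1, ..., C_k} of the other cells; C_0 may be empty. *)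
Definition quaternionic_GM_partition G C0 alpha : Prop :=
  [/\ partition alpha (~: C0),
      forall Ci Cj : {set V}, Ci \in alpha -> Cj \in alpha ->
        forall v v', v \in Ci -> v' \in Ci ->
          gain_sum G Cj v = gain_sum G Cj v'
    & forall v (Ci : {set V}), v \in C0 -> Ci \in alpha ->
        (exists q1 q2, half_half G Ci v q1 q2) \/ gain_sum G Ci v = 0].

Definition swap q1 q2 q : quat R :=
  if q == q1 then q2 else if q == q2 then q1 else q.

(* The value at (v, w) of the switched gain extended by 0, for v in C_0 and w
   in the cell C.  When C is nonempty, the pair (q1, q2) of [half_half] is
   unique up to order, hence the result does not depend on the choice made by
   [xget]. *)
Definition switch_gain G C v w : quat R :=
  if `[< exists q1 q2, half_half G C v q1 q2 >] then
    let p := xget (0, 0) (fun p => half_half G C v p.1 p.2) in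
    swap p.1 p.2 (gain0 G v w)
  else - gain0 G v w.

Definition switched_gain G C0 alpha u v : quat R :=
  if u \in C0 then
    if v \in C0 then gain0 G u v else switch_gain G (pblock alpha v) u v
  else
    if v \in C0 then (switch_gain G (pblock alpha u) v u)^-1 else gain0 G u v.

Definition switched_adj G C0 alpha : rel V :=
  fun u v => switched_gain G C0 alpha u v != 0.

Lemma gain0_unit_or_zero G u v : unit_or_zero (gain0 G u v).
Proof.
by rewrite /gain0; case: ifPn => [/gain_norm ?|_]; [right | left].
Qed.

Lemma gain0_inv G u v : gain0 G u v = (gain0 G v u)^-1.
Proof.
rewrite /gain0 (adj_sym G v u); case: ifP => [/gain_inv //|_].
by rewrite invr0.
Qed.

Lemma gain0_diag G v : gain0 G v v = 0.
Proof. by rewrite /gain0 adj_irr. Qed.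

Lemma gain0_eq0 G u v : (gain0 G u v == 0) = ~~ adj G u v.
Proof.
rewrite /gain0; case: ifP => [/gain_norm/qnorm1_neq0/negbTE //|_].
by rewrite eqxx.
Qed.

Lemma unit_or_zeroN q : unit_or_zero q -> unit_or_zero (- q).
Proof. by case=> [->|q1]; [left; rewrite oppr0 | right; rewrite qnormN]. Qed.

Lemma unit_or_zeroV q : unit_or_zero q -> unit_or_zero q^-1.
Proof.
case=> [->|q1]; first by left; rewrite invr0.
by right; rewrite qnorm1_inv ?qnorm_conj.
Qed.

Lemma switch_gain_unit_or_zero G C v w : unit_or_zero (switch_gain G C v w).
Proof.
have gP := gain0_unit_or_zero G v w.
rewrite /switch_gain; case: asboolP => [[q1 [q2 h]]|_]; last exact: unit_or_zeroN.
have [u1 u2 _] := xgetI (0, 0) (h : (fun p => half_half G C v p.1 p.2) (q1, q2)).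
by rewrite /swap; case: ifP => // _; case: ifP.
Qed.

Lemma switched_gain_unit_or_zero G C0 alpha u v :
  unit_or_zero (switched_gain G C0 alpha u v).
Proof.
rewrite /switched_gain; case: ifP => _; case: ifP => _.
- exact: gain0_unit_or_zero.
- exact: switch_gain_unit_or_zero.
- exact/unit_or_zeroV/switch_gain_unit_or_zero.
- exact: gain0_unit_or_zero.
Qed.

Lemma switched_gainV G C0 alpha u v :
  switched_gain G C0 alpha u v = (switched_gain G C0 alpha v u)^-1.
Proof.
rewrite /switched_gain; case: (u \in C0); case: (v \in C0) => //.
- exact: gain0_inv.
- by rewrite invrK.
- exact: gain0_inv.
Qed.

Lemma switched_adj_sym G C0 alpha : symmetric (switched_adj G C0 alpha).
Proof.
move=> u v; rewrite /switched_adj switched_gainV; congr (~~ _).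
by apply/eqP/eqP => [h|->]; [rewrite -[LHS]invrK h invr0 | rewrite invr0].
Qed.

Lemma switched_adj_irr G C0 alpha : irreflexive (switched_adj G C0 alpha).
Proof.
by move=> v; rewrite /switched_adj /switched_gain; case: ifP => -> /=;
  rewrite gain0_diag eqxx.
Qed.

Lemma switched_gain_norm G C0 alpha u v :
  switched_adj G C0 alpha u v -> qnorm (switched_gain G C0 alpha u v) = 1.
Proof.
by move/eqP; case: (switched_gain_unit_or_zero G C0 alpha u v).
Qed.

Definition switched_graph G C0 alpha : gain_graph R V :=
  GainGraph (switched_adj_sym G C0 alpha) (switched_adj_irr G C0 alpha)
    (@switched_gain_norm G C0 alpha)
    (fun u v _ => switched_gainV G C0 alpha u v).

Lemma gain0_switched G C0 alpha u v :
  gain0 (switched_graph G C0 alpha) u v = switched_gain G C0 alpha u v.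
Proof. by rewrite /gain0 /= /switched_adj; case: eqP. Qed.

Lemma adjacency_hermitian G : qhermitian (adjacency G).
Proof.
apply/matrixP => i j; rewrite !mxE gain0_inv.
case: (gain0_unit_or_zero G (enum_val j) (enum_val i)) => [->|/qnorm1_inv //].
by rewrite invr0; congr Quat; rewrite /= oppr0.
Qed.

(* Any admissible pair (q1, q2) gives the same switched gain. *)
Lemma switch_gain_half G C v w q1 q2 : w \in C -> half_half G C v q1 q2 ->
  switch_gain G C v w = swap q1 q2 (gain0 G v w).
Proof.
move=> wC h; rewrite /switch_gain asboolT; last by exists q1, q2.
have := xgetI (0, 0) (h : (fun p => half_half G C v p.1 p.2) (q1, q2)).
case: xget => p1 p2 /= {}h'.
have all_half a b : half_half G C v a b ->
    forall x, x \in C -> gain0 G v x = a \/ gain0 G v x = b.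
  case=> _ _ [[_ e] x /e|[nab ca cb] x xC]; first by left.
  set A := [set _ in _ | _ ] in ca; set B := [set _ in _ | _ ] in cb.
  have dAB : A :&: B = set0.
    apply/setP => y; rewrite !inE; apply/negP.
    by move=> /andP[/andP[_ /eqP ya] /andP[_ /eqP yb]]; apply: nab; rewrite -ya.
  have sAB : A :|: B \subset C.
    by apply/subsetP => y; rewrite !inE => /orP[] /andP[].
  have cAB : #|C| = #|A :|: B|.
    rewrite cardsU dAB cards0 subn0; apply: double_inj.
    by rewrite doubleD ca cb addnn.
  have /eqP eAB : A :|: B == C by rewrite eqEcard sAB cAB leqnn.
  by move: xC; rewrite -eAB !inE => /orP[] /andP[_ /eqP]; [left | right].
have wit a b : half_half G C v a b ->
    (exists2 x, x \in C & gain0 G v x = a) /\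
    (exists2 x, x \in C & gain0 G v x = b).
  have C0 : (0 < #|C|)%N by apply/card_gt0P; exists w.
  case=> _ _ [[<- e]|[_ ca cb]]; first by split; exists w => //; apply: e.
  split.
    have /card_gt0P[x] : (0 < #|[set w in C | gain0 G v w == a]|)%N.
      by rewrite -double_gt0 ca.
    by rewrite !inE => /andP[xC /eqP xa]; exists x.
  have /card_gt0P[x] : (0 < #|[set w in C | gain0 G v w == b]|)%N.
    by rewrite -double_gt0 cb.
  by rewrite !inE => /andP[xC /eqP xb]; exists x.
have [[x xC xa] [y yC yb]] := wit _ _ h.
have [[x' xC' xa'] [y' yC' yb']] := wit _ _ h'.
have := all_half _ _ h' _ xC; have := all_half _ _ h' _ yC.
have := all_half _ _ h _ xC'; have := all_half _ _ h _ yC'.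
rewrite xa yb xa' yb' /swap => e1 e2 e3 e4.
have : (p1 = q1 /\ p2 = q2) \/ (p1 = q2 /\ p2 = q1).
  by intuition congruence.
case=> -[-> ->] //.
by case: eqP => [->|//]; case: eqP => // ->.
Qed.

End GainGraphs.

(* Main.v *)
Require Import Defs.
From mathcomp Require Import all_boot all_order all_algebra reals.
From HB Require Import structures.
From mathcomp Require Import boolp ring lra complex spectral.

Set Implicit Arguments.
Unset Strict Implicit.
Unset Printing Implicit Defensive.

Import Order.TTheory GRing.Theory Num.Theory.
Local Open Scope ring_scope.

(** The switched adjacency matrix is [K *m A *m K], where [A] is the adjacency
    matrix and [K] is the real symmetric matrix acting as the identity on the
    vertices of [C0] and, on each other cell [C] with [n] vertices, as
    [(2 / n) J - I], [J] being the all-ones matrix.  This block is the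
    reflection that fixes the constant vectors and negates the vectors of sum
    zero, so [K] is an involution, hence unitary.

    It is enough to see that [A' K = K A] ([switched_intertwine]), entry by
    entry.  Write [S] for the sum of the gains from [v] in [C0] to a cell [C].
    The reflection replaces each gain [g] of that row by [(2 / n) S - g].  If the
    gains take the two values [q1] and [q2] equally often (or [q1 = q2]), then
    [(2 / n) S = q1 + q2] and the result is the swapped gain; if [S = 0], the
    result is [- g].  So switching the edges between [C0] and the cells is
    exactly the reflection.  Between two cells [C] and [C'], the row sums are
    constant by hypothesis and the column sums are constant because [A] is
    Hermitian; counting the total of the block in two ways shows that the two
    reflections change it by the same multiple of [J], so that conjugating by
    [K] leaves it fixed.

    Unitary conjugation preserves the right spectrum, once there is one: this is
    the quaternionic spectral theorem ([quaternionic_spectral]), proved by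
    deflation.  Reading quaternions as pairs of complex numbers turns row
    vectors times [A] into complex vectors times a matrix of twice the size,
    which has an eigenvector; so [x A = q x] for some nonzero [x] and some
    quaternion [q].  This [q] is real because [x A x^H] and [x x^H] are, where
    [^H] is the conjugate transpose.
    After multiplication of [x] on the left by a suitable quaternion, a
    Householder reflection sends the first basis vector to [x], and conjugating
    by it splits off a diagonal entry. *)

(** * Quaternions: real scalars and conjugation *)

Section QuatAlgebra.
Variable R : realType.
Implicit Types (x y : quat R) (a b : R).

Lemma quat_real_is_zmod_morphism : zmod_morphism (@quat_real R).
Proof. by move=> a b; congr Quat; rewrite /= oppr0 addr0. Qed.

HB.instance Definition _ := GRing.isZmodMorphism.Build R (quat R)
  (@quat_real R) quat_real_is_zmod_morphism.

Lemma quat_real_is_monoid_morphism : monoid_morphism (@quat_real R).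
Proof. by split=> // a b; rewrite quat_realM. Qed.

HB.instance Definition _ := GRing.isMonoidMorphism.Build R (quat R)
  (@quat_real R) quat_real_is_monoid_morphism.

Lemma qconj_is_zmod_morphism : zmod_morphism (@qconj R).
Proof. by move=> x y; congr Quat; rewrite /= opprD. Qed.

HB.instance Definition _ := GRing.isZmodMorphism.Build (quat R) (quat R)
  (@qconj R) qconj_is_zmod_morphism.

Lemma qconjK : involutive (@qconj R).
Proof. by case=> a b c d; congr Quat; rewrite /= opprK. Qed.

Lemma qconjM x y : qconj (x * y) = qconj y * qconj x.
Proof. by case: x => ????; case: y => ????; congr Quat => /=; ring. Qed.

Lemma qconj_real a : qconj (quat_real a) = quat_real a.
Proof. by congr Quat; rewrite /= oppr0. Qed.

Lemma qconj1 : qconj 1 = 1 :> quat R.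
Proof. exact: qconj_real. Qed.

Lemma qconj_eq_real x : qconj x = x -> x = quat_real (qre x).
Proof. by case: x => a b c d [hb hc hd]; congr Quat; lra. Qed.

End QuatAlgebra.

(** * Conjugate transpose of rectangular quaternionic matrices *)

Section ConjugateTranspose.
Variable R : realType.

(** The operation [qadjoint], for rectangular matrices: row vectors and blocks
    are needed as well. *)
Definition conj_tr m n (A : 'M[quat R]_(m, n)) : 'M[quat R]_(n, m) :=
  map_mx (@qconj R) A^T.

Local Notation "A ^H" := (conj_tr A) (at level 8, format "A ^H").

Lemma conj_trK m n (A : 'M[quat R]_(m, n)) : A^H^H = A.
Proof. by apply/matrixP => i j; rewrite !mxE qconjK. Qed.

Lemma conj_trM m n p (A : 'M[quat R]_(m, n)) (B : 'M[quat R]_(n, p)) :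
  (A *m B)^H = B^H *m A^H.
Proof.
apply/matrixP => i j; rewrite !mxE raddf_sum; apply: eq_bigr => k _.
by rewrite /= qconjM !mxE.
Qed.

Lemma conj_trB m n (A B : 'M[quat R]_(m, n)) : (A - B)^H = A^H - B^H.
Proof. by apply/matrixP => i j; rewrite !mxE raddfB. Qed.

Lemma conj_tr_realZ a m n (A : 'M[quat R]_(m, n)) :
  (quat_real a *: A)^H = quat_real a *: A^H.
Proof. by apply/matrixP => i j; rewrite !mxE qconjM qconj_real quat_realC. Qed.

Lemma conj_tr0 m n : (0 : 'M[quat R]_(m, n))^H = 0.
Proof. by rewrite /conj_tr trmx0 map_mx0. Qed.

Lemma conj_tr1 n : (1%:M : 'M[quat R]_n)^H = 1%:M.
Proof.
by apply/matrixP => i j; rewrite !mxE eq_sym; case: eqP; rewrite ?qconj1 ?raddf0.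
Qed.

(** Quaternions do not commute, so a scalar on the left of the second factor
    can be moved to the front only when it is real. *)
Lemma mulmx_realZ a m n p (A : 'M[quat R]_(m, n)) (B : 'M[quat R]_(n, p)) :
  A *m (quat_real a *: B) = quat_real a *: (A *m B).
Proof.
apply/matrixP => i j; rewrite !mxE mulr_sumr; apply: eq_bigr => k _.
by rewrite !mxE !mulrA quat_realC.
Qed.

Lemma conj_tr_block m1 m2 n1 n2 (Aul : 'M[quat R]_(m1, n1)) (Aur : 'M_(m1, n2))
    (Adl : 'M_(m2, n1)) (Adr : 'M_(m2, n2)) :
  (block_mx Aul Aur Adl Adr)^H = block_mx Aul^H Adl^H Aur^H Adr^H.
Proof. by rewrite /conj_tr tr_block_mx map_block_mx. Qed.

Definition sqnorm n (x : 'rV[quat R]_n) : R := \sum_i qsqnorm (x 0 i).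

Lemma mul_conj_tr_row n (x : 'rV[quat R]_n) : x *m x^H = (quat_real (sqnorm x))%:M.
Proof.
apply/matrixP => i j; rewrite !ord1 !mxE mulr1n raddf_sum.
by apply: eq_bigr => k _; rewrite !mxE mulq_conj.
Qed.

Lemma sqnorm_gt0 n (x : 'rV[quat R]_n) : x != 0 -> 0 < sqnorm x.
Proof.
move=> x0; rewrite lt_neqAle sumr_ge0 ?andbT => [|i _]; last exact: qsqnorm_ge0.
apply: contraNneq x0 => /esym/eqP; rewrite psumr_eq0 => [/allP h|i _]; last first.
  exact: qsqnorm_ge0.
apply/eqP/rowP => i; rewrite mxE; apply/eqP; rewrite -qsqnorm_eq0.
exact: h (mem_index_enum i).
Qed.

Lemma qsqnormM (x y : quat R) : qsqnorm (x * y) = qsqnorm x * qsqnorm y.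
Proof. by case: x => ????; case: y => ????; rewrite /qsqnorm /=; ring. Qed.

Lemma sqnormZ n q (x : 'rV[quat R]_n) : sqnorm (q *: x) = qsqnorm q * sqnorm x.
Proof.
by rewrite /sqnorm mulr_sumr; apply: eq_bigr => i _; rewrite mxE qsqnormM.
Qed.

(** * Left eigenvectors with real eigenvalue *)

(** The quaternion [z + w j].  As [j z = conjc z * j], this pairing turns right
    multiplication by a quaternion into a complex linear map. *)
Definition quat_of_complexes (z w : R[i]) : quat R :=
  Quat (complex.Re z) (complex.Im z) (complex.Re w) (complex.Im w).
Definition complex1 (q : quat R) : R[i] := Complex (qre q) (qi q).
Definition complex2 (q : quat R) : R[i] := Complex (qj q) (qk q).

Lemma complex1K z w : complex1 (quat_of_complexes z w) = z.
Proof. by case: z. Qed.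
Lemma complex2K z w : complex2 (quat_of_complexes z w) = w.
Proof. by case: w. Qed.

Lemma quat_of_complexesM z w q :
  quat_of_complexes z w * q =
  quat_of_complexes (z * complex1 q - w * conjc (complex2 q))
                    (z * complex2 q + w * conjc (complex1 q)).
Proof. by case: z => ??; case: w => ??; case: q => ????; congr Quat => /=; ring. Qed.

Lemma quat_of_complexes_sum (I : finType) (F H : I -> R[i]) :
  quat_of_complexes (\sum_i F i) (\sum_i H i) =
  \sum_i quat_of_complexes (F i) (H i).
Proof.
apply: (big_ind3 (fun z w q => quat_of_complexes z w = q)) => //.
by move=> [? ?] [? ?] _ [? ?] [? ?] _ <- <-.
Qed.

(** With [x = v1 + v2 j] and [A = A1 + A2 j], the coordinates of [x *m A] are
    [row_mx v1 v2 *m block_mx A1 A2 (- conj A2) (conj A1)], so an eigenvector of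
    this complex matrix gives [x].  The eigenvalue stays on the left of [x]:
    only left multiplication by a complex number is complex linear here. *)
Lemma complex_left_eigenvector n (A : 'M[quat R]_n) : (0 < n)%N ->
  exists (z : R[i]) (x : 'rV[quat R]_n),
    x != 0 /\ x *m A = quat_of_complexes z 0 *: x.
Proof.
move=> n0.
pose M : 'M[R[i]]_(n + n) :=
  block_mx (map_mx complex1 A) (map_mx complex2 A)
    (- map_mx (@conjc R) (map_mx complex2 A))
    (map_mx (@conjc R) (map_mx complex1 A)).
have [|z /eigenvalueP[u uM u0]] := eigenvalue_closed M.
  by rewrite addn_gt0 n0.
exists z, (map2_mx quat_of_complexes (lsubmx u) (rsubmx u)).
split.
  apply: contra_neq u0 => x0; apply/rowP => i; rewrite mxE.
  rewrite -(splitK i); case: (split i) => j /=.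
    move/rowP/(_ j): x0; rewrite !mxE => -[] /= h1 h2 _ _.
    by apply/eqP; rewrite eq_complex h1 h2 !eqxx.
  move/rowP/(_ j): x0; rewrite !mxE => -[] /= _ _ h1 h2.
  by apply/eqP; rewrite eq_complex h1 h2 !eqxx.
move: uM; rewrite -[u in u *m _]hsubmxK mul_row_block -[u in RHS]hsubmxK.
rewrite scale_row_mx => /eq_row_mx[/rowP e1 /rowP e2].

have mulE (x v : 'rV[R[i]]_n) (B C : 'M[R[i]]_n) l :
    (x *m B + v *m C) 0 l = \sum_k (x 0 k * B k l + v 0 k * C k l).
  by rewrite !mxE big_split.
apply/rowP => l; move: (e1 l) (e2 l); rewrite !mulE.
rewrite [(z *: lsubmx u) 0 l]mxE [(z *: rsubmx u) 0 l]mxE => {}e1 {}e2.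
rewrite [LHS]mxE [RHS]mxE [in RHS]mxE quat_of_complexesM complex1K complex2K.
rewrite !mul0r subr0 addr0 -e1 -e2 quat_of_complexes_sum; apply: eq_bigr => k _.
by rewrite [map2_mx _ _ _ _ _]mxE quat_of_complexesM !mxE mulrN.
Qed.

(** If [x A = q x], then [q x x^H = x A x^H] is equal to its own conjugate,
    hence real; and [x x^H] is a positive real, so [q] is real. *)
Lemma real_left_eigenvector n (A : 'M[quat R]_n) : (0 < n)%N -> A^H = A ->
  exists (a : R) (x : 'rV[quat R]_n), x != 0 /\ x *m A = quat_real a *: x.
Proof.
move=> n0 AH; have [z [x [x0 xA]]] := complex_left_eigenvector A n0.
set q := quat_of_complexes z 0 in xA.
have s0 := sqnorm_gt0 x0.
have E : x *m A *m x^H = (q * quat_real (sqnorm x))%:M.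
  by rewrite xA -scalemxAl mul_conj_tr_row scale_scalar_mx.
have EH : (x *m A *m x^H)^H = x *m A *m x^H by rewrite !conj_trM conj_trK AH mulmxA.
have /qconj_eq_real qs : qconj (q * quat_real (sqnorm x)) = q * quat_real (sqnorm x).
  by move/matrixP/(_ 0 0): EH; rewrite E !mxE !mulr1n.
exists (qre (q * quat_real (sqnorm x)) / sqnorm x), x; split=> //.
rewrite xA rmorphM /= -qs -mulrA -rmorphM /= divff ?gt_eqF //.
by rewrite mulr1.
Qed.

(** * The quaternionic spectral theorem *)

(** The reflection along [v = x - e], with [e] the first basis vector.  It
    exchanges [e] and [x] only if their scalar product is real, since otherwise
    [x - e] and [x + e] are not orthogonal over the quaternions.  Asking for
    [t <= 0] also keeps [v] away from zero: [v v^H = 2 (1 - t) >= 2]. *)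
Lemma householder_to_row n (x : 'rV[quat R]_n.+1) (t : R) :
    sqnorm x = 1 -> x 0 0 = quat_real t -> t <= 0 ->
  exists2 H : 'M[quat R]_n.+1, H^H = H /\ H *m H = 1%:M & delta_mx 0 0 *m H = x.
Proof.
move=> x1 xt t0; set e := delta_mx 0 0 : 'rV[quat R]_n.+1.
pose v := x - e; pose c := (1 - t)^-1.
have ct : c * (1 - t) = 1 by rewrite mulVf // gt_eqF //; lra.
have eH m (B : 'M[quat R]_(m, n.+1)) : B *m e^H = col 0 B.
  apply/matrixP => i j; rewrite !mxE (bigD1 0) //= big1 ?addr0 => [|k k0].
    by rewrite !mxE ord1 eqxx qconj1 mulr1.
  by rewrite !mxE (negbTE k0) andbF raddf0 mulr0.
have ev : e *m v^H = (quat_real (t - 1))%:M.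
  rewrite -[LHS]conj_trK conj_trM conj_trK eH; apply/matrixP => i j.
  by rewrite !ord1 !mxE xt !eqxx -[1]/(quat_real 1) -rmorphB qconj_real.
have vv : v *m v^H = (quat_real (2 * (1 - t)))%:M.
  rewrite {1}/v mulmxBl ev /v conj_trB mulmxBr mul_conj_tr_row x1 eH.
  apply/matrixP => i j; rewrite !ord1 !mxE xt !mulr1n -!rmorphB /=.
  by congr quat_real; ring.
pose P := v^H *m v.
have PP : P *m P = quat_real (2 * (1 - t)) *: P.
  rewrite /P mulmxA -(mulmxA v^H) vv -mulmxA mul_scalar_mx.
  exact: mulmx_realZ.
exists (1%:M - quat_real c *: P).
  split; first by rewrite conj_trB conj_tr1 conj_tr_realZ conj_trM conj_trK.
  rewrite mulmxBl mul1mx mulmxBr mulmx1 mulmx_realZ -scalemxAl PP.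
  rewrite !scalerA -!rmorphM /=.
  have -> : c * c * (2 * (1 - t)) = c + c.
    by transitivity (2 * c * (c * (1 - t))); [ring | rewrite ct; ring].
  by rewrite rmorphD scalerDl opprB addrK subrK.
rewrite mulmxBr mulmx1 mulmx_realZ /P mulmxA ev mul_scalar_mx scalerA -rmorphM.
have -> : c * (t - 1) = -1 by rewrite -(opprB 1) mulrN ct.
by rewrite rmorphN1 scaleN1r opprK addrC subrK.
Qed.

(** Left multiples of a left eigenvector for a real eigenvalue are again such
    eigenvectors, so this supplies the hypotheses of the Householder step. *)
Lemma normalized_multiple n (x : 'rV[quat R]_n.+1) : x != 0 ->
  exists (q : quat R) (t : R),
    [/\ sqnorm (q *: x) = 1, (q *: x) 0 0 = quat_real t & t <= 0].
Proof.
move=> x0; have s0 := sqnorm_gt0 x0.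
have [p [t [p1 pt t0]]] : exists (p : quat R) (t : R),
    [/\ qsqnorm p = 1, p * x 0 0 = quat_real t & t <= 0].
  have [y0|y0] := eqVneq (x 0 0) 0.
    by exists 1, 0; rewrite y0 mulr0 rmorph0; split=> //; rewrite /qsqnorm /=; ring.
  set y := x 0 0 in y0 *.
  have n0 : 0 < qsqnorm y by rewrite lt_neqAle eq_sym qsqnorm_eq0 y0 qsqnorm_ge0.
  have r2 := sqr_sqrtr (ltW n0).
  have r0 : 0 < Num.sqrt (qsqnorm y) by rewrite sqrtr_gt0.
  (* The unit quaternion [- qconj y / qnorm y] turns [y] into [- qnorm y]. *)
  exists (quat_real (- (Num.sqrt (qsqnorm y))^-1) * qconj y), (- Num.sqrt (qsqnorm y)).
  split; last by rewrite oppr_le0 ltW.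
    rewrite qsqnormM (_ : qsqnorm (qconj y) = qsqnorm y); last first.
      by rewrite /qsqnorm /= !sqrrN.
    rewrite -[X in _ * X]r2 /qsqnorm /=; field.
    by rewrite gt_eqF.
  rewrite -mulrA mulconj_q -rmorphM -[X in _ * X]r2; congr quat_real.
  by field; rewrite gt_eqF.
pose c := (Num.sqrt (sqnorm x))^-1.
have c0 : 0 < c by rewrite invr_gt0 sqrtr_gt0.
exists (quat_real c * p), (c * t); split; last by rewrite pmulr_rle0.
  rewrite sqnormZ qsqnormM p1 mulr1 -[X in _ * X](sqr_sqrtr (ltW s0)) /c.
  rewrite /qsqnorm /=; field.
  by rewrite gt_eqF // sqrtr_gt0.
by rewrite mxE -mulrA pt -rmorphM.
Qed.

(** Induction on the size: the Householder reflection [H] whose first row is an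
    eigenvector makes [H A H] block diagonal, as its first row is a multiple of
    the first basis vector and it is Hermitian. *)
Lemma quaternionic_spectral n (A : 'M[quat R]_n) : A^H = A ->
  exists (W : 'M[quat R]_n) (d : 'rV[R]_n),
    [/\ W *m W^H = 1%:M, W^H *m W = 1%:M
      & W *m A *m W^H = diag_mx (map_mx (@quat_real R) d)].
Proof.
elim: n A => [|n IH] A AH.
  exists 1%:M, 0; split; apply/matrixP; case=> //.
have [a [y [y0 yA]]] := real_left_eigenvector (ltn0Sn n) AH.
have [q [t [x1 xt t0]]] := normalized_multiple y0.
have [H [HH HK] eHx] := householder_to_row x1 xt t0.
have xA : q *: y *m A = quat_real a *: (q *: y).
  by rewrite -scalemxAl yA !scalerA quat_realC.
have eB : (delta_mx 0 0 : 'rV_n.+1) *m (H *m A *m H) = quat_real a *: delta_mx 0 0.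
  by rewrite !mulmxA eHx xA -scalemxAl -eHx -mulmxA HK mulmx1.
have BH : (H *m A *m H)^H = H *m A *m H by rewrite !conj_trM HH AH mulmxA.
have [B defB] : exists B : 'M_(1 + n), B = H *m A *m H by exists (H *m A *m H).
rewrite -defB in eB BH.
have eB' j : B 0 j = quat_real a *+ (j == 0).
  move/rowP/(_ j): eB; rewrite -rowE !mxE eqxx /= => ->.
  by case: (j == 0); rewrite ?mulr1 ?mulr0.
have lshift0 : lshift n (0 : 'I_1) = 0 by apply/val_inj.
have Bul : ulsubmx B = (quat_real a)%:M.
  by apply/matrixP => i j; rewrite !ord1 !mxE lshift0 eB'.
have Bur : ursubmx B = 0.
  by apply/matrixP => i j; rewrite !ord1 !mxE lshift0 eB'.
have [Bdl Bdr] : dlsubmx B = 0 /\ (drsubmx B)^H = drsubmx B.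
  have {}BH : (B : 'M_(1 + n))^H = B := BH.
  move: BH; rewrite -[B]submxK conj_tr_block Bur => /eq_block_mx[_ _ h h'].
  by rewrite block_mxKdl block_mxKdr -h conj_tr0.
have [W [d [W1 W2 WB]]] := IH _ Bdr.
have B_block : B = block_mx (quat_real a)%:M 0 0 (drsubmx B).
  by rewrite -{1}[B]submxK Bul Bur Bdl.
pose W' : 'M_(1 + n) := block_mx 1%:M 0 0 W.
have W'H : W'^H = block_mx 1%:M 0 0 W^H.
  by rewrite /W' conj_tr_block conj_tr1 !conj_tr0.
have W'1 : W' *m W'^H = 1%:M.
  rewrite W'H mulmx_block !mulmx0 !mul0mx !addr0 add0r mul1mx W1.
  by rewrite -scalar_mx_block.
have W'2 : W'^H *m W' = 1%:M.
  rewrite W'H mulmx_block !mulmx0 !mul0mx !addr0 add0r mul1mx W2.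
  by rewrite -scalar_mx_block.
exists (W' *m H), (row_mx a%:M d); rewrite conj_trM HH; split.
- by rewrite mulmxA -(mulmxA W') HK mulmx1.
- by rewrite mulmxA -(mulmxA H) W'2 mulmx1.
transitivity (W' *m B *m W'^H); first by rewrite defB !mulmxA.
rewrite B_block W'H !mulmx_block.
rewrite !mulmx0 !mul0mx !addr0 !add0r mul1mx mulmx1 WB.
transitivity (diag_mx (map_mx (@quat_real R) (row_mx (a%:M : 'M_1) d))) => //.
have diag1 : diag_mx (map_mx (@quat_real R) (a%:M : 'M_1)) = (quat_real a)%:M.
  by apply/matrixP => i j; rewrite !ord1 !mxE.
by rewrite map_row_mx diag_mx_row diag1 ?mul0mx ?mulmx0.
Qed.
End ConjugateTranspose.

Lemma qadjointE (R : realType) n (A : 'M[quat R]_n) : qadjoint A = conj_tr A.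
Proof. by []. Qed.

(** If [W] diagonalizes [A], then [W *m K] diagonalizes [K^H A K] to the same
    diagonal; the spectral theorem provides [W]. *)
Lemma hermitian_conj_cospectral (R : realType) n (A K : 'M[quat R]_n) :
  qhermitian A -> qunitary K -> right_cospectral A (qadjoint K *m A *m K).
Proof.
move=> AH []; rewrite !qadjointE => K1 K2.
have [W [d [W1 W2 WA]]] := quaternionic_spectral (esym AH).
exists [seq d 0 i | i <- enum 'I_n].
  by exists (conj_tr W), d; split=> //; [split | ]; rewrite qadjointE conj_trK.
exists (qadjoint K *m conj_tr W), d; rewrite /qunitary !qadjointE conj_trM !conj_trK.
split=> //.
  split; first by rewrite mulmxA -(mulmxA (conj_tr K)) W2 mulmx1.
  by rewrite mulmxA -(mulmxA W) K1 mulmx1.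
transitivity (W *m (K *m conj_tr K) *m A *m (K *m conj_tr K) *m conj_tr W).
  by rewrite !mulmxA.
by rewrite K1 !mulmx1.
Qed.

(** * Gains between a vertex and a cell *)

Section CellGains.
Variables (R : realType) (V : finType).

Lemma qconj_gain0 (H : gain_graph R V) u v : qconj (gain0 H u v) = gain0 H v u.
Proof.
rewrite (gain0_inv H v u); case: (gain0_unit_or_zero H u v) => [->|/qnorm1_inv //].
by rewrite invr0 raddf0.
Qed.


Variable G : gain_graph R V.
Implicit Types (C : {set V}).

Lemma gain_sumE C v : gain_sum G C v = \sum_(w in C) gain0 G v w.
Proof. by rewrite /gain_sum big_mkcondr. Qed.

(** The two halves are disjoint, so by cardinality they cover the cell. *)
Lemma half_half_values C v q1 q2 w : half_half G C v q1 q2 -> w \in C ->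
  gain0 G v w = q1 \/ gain0 G v w = q2.
Proof.
case=> _ _ [[_ e] /e|[q12 c1 c2] wC]; first by left.
set A := [set _ in _ | _] in c1; set B := [set _ in _ | _] in c2.
have sub : A :|: B \subset C by apply/subsetP => x; rewrite !inE => /orP[]/andP[].
have dis : A :&: B = set0.
  apply/setP => x; rewrite !inE; apply/negP.
  by move=> /andP[/andP[_ /eqP xa] /andP[_ /eqP xb]]; apply: q12; rewrite -xa.
have /eqP eAB : A :|: B == C.
  rewrite eqEcard sub cardsU dis cards0 subn0 -leq_double doubleD c1 c2.
  by rewrite addnn leqnn.
by move: wC; rewrite -eAB !inE => /orP[]/andP[_ /eqP]; [left | right].
Qed.

Lemma half_half_sum C v q1 q2 : half_half G C v q1 q2 ->
  gain_sum G C v *+ 2 = (q1 + q2) *+ #|C|.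
Proof.
move=> h; have hv := half_half_values h; rewrite gain_sumE.
case: h => _ _ [[<- e]|[q12 c1 c2]].
  by rewrite (eq_bigr _ e) sumr_const -mulr2n mulrnAC.
rewrite (eq_bigr (fun w => (if gain0 G v w == q1 then q1 else 0)
    + (if gain0 G v w == q2 then q2 else 0))); last first.
  move=> w /hv[] ->; rewrite eqxx ?addr0.
    by rewrite (introF eqP q12) addr0.
  by rewrite (introF eqP (nesym q12)) add0r.
rewrite big_split /= -2!big_mkcondr !sumr_const mulrnDl -!mulrnA !muln2.
by rewrite mulrnDl -{1}c1 -c2 !cardsE.
Qed.

(** Both rules of switching are the single rule [g' + g = (2 / n) S], where [S]
    is the sum of the gains from [v] to the cell and [n] its size: [q1 + q2 - g]
    is the swapped value of [g], and [S = 0] gives [g' = - g]. *)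
Lemma switch_gainD C v w : w \in C ->
    (exists q1 q2, half_half G C v q1 q2) \/ gain_sum G C v = 0 ->
  (switch_gain G C v w + gain0 G v w) *+ #|C| = gain_sum G C v *+ 2.
Proof.
move=> wC; case: (pselect (exists q1 q2, half_half G C v q1 q2)) => [[q1 [q2 h]] _|nh].
  rewrite (switch_gain_half wC h) (half_half_sum h); congr (_ *+ _).
  rewrite /swap; case: (half_half_values h wC) => ->; rewrite eqxx; first exact: addrC.
  by case: eqP => [->|].
case=> // ->; rewrite /switch_gain asboolF // addNr !mul0rn //.
Qed.

End CellGains.

(** * Reflection in the cells *)

Section Switching.
Variables (R : realType) (V : finType).

Definition vertex_mx (f : V -> V -> quat R) : 'M[quat R]_#|V| :=
  \matrix_(i, j) f (enum_val i) (enum_val j).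

Lemma vertex_mxM f g :
  vertex_mx f *m vertex_mx g = vertex_mx (fun u v => \sum_w f u w * g w v).
Proof.
apply/matrixP => i j; rewrite !mxE [RHS](reindex _ (onW_bij _ (enum_val_bij V))).
by apply: eq_bigr => k _; rewrite !mxE.
Qed.

Lemma eq_vertex_mx f g : f =2 g -> vertex_mx f = vertex_mx g.
Proof. by move=> e; apply/matrixP => i j; rewrite !mxE e. Qed.

Lemma vertex_mx1 : vertex_mx (fun u v => (u == v)%:R) = 1%:M.
Proof. by apply/matrixP => i j; rewrite !mxE (inj_eq enum_val_inj). Qed.

Variables (C0 : {set V}) (alpha : {set {set V}}).
Hypothesis part : partition alpha (~: C0).

Let cell := pblock alpha.

Definition cell_wt u : R := 2 / #|cell u|%:R.

(** The entries of the matrix of [cell_reflect].  A vertex of [C0] belongs to no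
    set of [alpha], so its [cell] is the empty set, the default value of
    [pblock], and the second term vanishes for it. *)
Definition reflection_entry (u v : V) : quat R :=
  (if u \in C0 then 1 else -1) * (u == v)%:R
  + quat_real (cell_wt u * (v \in cell u)%:R).

Definition cell_reflect (f : V -> quat R) u :=
  if u \in C0 then f u else quat_real (cell_wt u) * (\sum_(w in cell u) f w) - f u.

Lemma cell_C0 u : u \in C0 -> cell u = set0.
Proof.
move=> uC; rewrite /cell /pblock; case: pickP => // A /andP[AP uA].
have /and3P[/eqP cov _ _] := part.
suff : u \in ~: C0 by rewrite inE uC.
by rewrite -cov; apply/bigcupP; exists A.
Qed.

Lemma mem_cell u : u \notin C0 -> u \in cell u.
Proof.
have /and3P[/eqP cov _ _] := part.
by move=> uC; rewrite mem_pblock cov inE.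
Qed.

Lemma mem_cell_alpha u : u \notin C0 -> cell u \in alpha.
Proof.
have /and3P[/eqP cov _ _] := part.
by move=> uC; rewrite pblock_mem // cov inE.
Qed.

Lemma same_cell u v : v \in cell u -> cell v = cell u.
Proof.
have /and3P[_ tI _] := part.
by move=> /same_pblock; apply.
Qed.

Lemma cell_notin u v : v \in cell u -> v \notin C0.
Proof.
case: (boolP (u \in C0)) => [/cell_C0-> |uC]; first by rewrite inE.
move=> vu; have /and3P[/eqP cov _ _] := part.
suff : v \in ~: C0 by rewrite inE.
by rewrite -cov; apply/bigcupP; exists (cell u) => //; exact: mem_cell_alpha.
Qed.

Lemma cell_sym u v : (v \in cell u) = (u \in cell v).
Proof.
by apply/idP/idP => h; rewrite (same_cell h) mem_cell ?(cell_notin h) //;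
 apply: contraL h => /cell_C0 ->; rewrite inE.
Qed.

Lemma reflection_entryC u v : reflection_entry u v = reflection_entry v u.
Proof.
rewrite /reflection_entry (eq_sym v) (cell_sym v) /cell_wt.
case: eqP => [->//|_].
by case: (boolP (v \in cell u)) => [/same_cell->|_]; rewrite ?mulr0.
Qed.

Lemma reflection_suml f u : \sum_w reflection_entry u w * f w = cell_reflect f u.
Proof.
rewrite /reflection_entry; under eq_bigr do rewrite mulrDl.
rewrite big_split (bigD1 u) //= eqxx mulr1 [X in _ + X + _]big1 ?addr0; last first.
  by move=> w; rewrite eq_sym => /negbTE->; rewrite mulr0 mul0r.
have -> : \sum_w quat_real (cell_wt u * (w \in cell u)%:R) * f w
  = quat_real (cell_wt u) * (\sum_(w in cell u) f w).
  rewrite mulr_sumr [RHS]big_mkcond; apply: eq_bigr => w _.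
  by case: (w \in cell u); rewrite ?mulr1 // mulr0 raddf0 mul0r.
rewrite /cell_reflect; case: ifP => [uC|_]; last by rewrite mulN1r addrC.
by rewrite cell_C0 // big_set0 mulr0 addr0 mul1r.
Qed.

Lemma reflection_sumr f u : \sum_w f w * reflection_entry w u = cell_reflect f u.
Proof.
rewrite -reflection_suml; apply: eq_bigr => w _.
rewrite reflection_entryC /reflection_entry mulrDr mulrDl -quat_realC; congr (_ + _).
case: (u \in C0); rewrite !(mul1r, mulN1r) ?mulNr ?mulrN; case: (u == w);
  by rewrite ?(mul1r, mulr1, mulr0, mul0r).
Qed.

Lemma card_cell_neq0 u : u \notin C0 -> #|cell u|%:R != 0 :> R.
Proof.
move=> uC; rewrite pnatr_eq0 -lt0n; apply/card_gt0P; exists u; exact: mem_cell.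
Qed.

Lemma quat_mulrn (x : quat R) n : x *+ n = quat_real n%:R * x.
Proof. by rewrite rmorph_nat mulr_natl. Qed.

Lemma cell_wtE u s y : u \notin C0 ->
  s *+ 2 = y *+ #|cell u| -> quat_real (cell_wt u) * s = y.
Proof.
move=> uC; rewrite !quat_mulrn /cell_wt => e.
rewrite mulrC rmorphM -mulrA e mulrA -rmorphM mulVf ?mul1r //.
exact: card_cell_neq0.
Qed.

(** In a cell of size [n] a family of sum [S] becomes one of sum
    [n (2 / n) S - S = S], so the second reflection subtracts from the same
    constant. *)
Lemma cell_reflectK f : cell_reflect (cell_reflect f) =1 f.
Proof.
move=> u; rewrite {1}/cell_reflect; case: ifP => uC; first by rewrite /cell_reflect uC.
have uC' : u \notin C0 by rewrite uC.
rewrite (cell_wtE uC' (y := quat_real (cell_wt u) * \sum_(w in cell u) f w)).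
  by rewrite /cell_reflect uC opprB addrC subrK.
pose S := \sum_(w in cell u) f w.
have -> : \sum_(w in cell u) cell_reflect f w
    = (quat_real (cell_wt u) * S) *+ #|cell u| - S.
  rewrite -sumr_const -sumrB; apply: eq_bigr => w wu.
  by rewrite /cell_reflect (negbTE (cell_notin wu)) /cell_wt (same_cell wu).
have -> : (quat_real (cell_wt u) * S) *+ #|cell u| = S *+ 2.
  by rewrite !quat_mulrn mulrA -rmorphM mulrC divfK ?card_cell_neq0.
by rewrite -/S mulr2n addrK -mulr2n.
Qed.

Lemma reflectionK : vertex_mx reflection_entry *m vertex_mx reflection_entry = 1%:M.
Proof.
rewrite vertex_mxM -vertex_mx1; apply: eq_vertex_mx => u v.
rewrite reflection_suml -[RHS](cell_reflectK (fun w => (w == v)%:R)); congr cell_reflect.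
apply: funext => w; rewrite -reflection_suml (bigD1 v) //= eqxx mulr1.
by rewrite big1 ?addr0 // => x /negbTE->; rewrite mulr0.
Qed.

Lemma reflection_conj_tr :
  conj_tr (vertex_mx reflection_entry) = vertex_mx reflection_entry.
Proof.
apply/matrixP => i j; rewrite !mxE reflection_entryC.
rewrite /reflection_entry raddfD /= qconj_real.
congr (_ + _); rewrite qconjM.
have qN : qconj (-1) = -1 :> quat R by rewrite raddfN /= qconj1.
by case: ifP => _; case: eqP => _;
  rewrite ?(mulr1n, mulr0n) ?raddf0 ?mulr0 ?mul0r ?qconj1 ?qN ?mulr1 ?mul1r.
Qed.

(** * Switching is conjugation by the reflection *)

Variable G : gain_graph R V.

Hypothesis regular : forall Ci Cj : {set V}, Ci \in alpha -> Cj \in alpha ->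
  forall v v', v \in Ci -> v' \in Ci -> gain_sum G Cj v = gain_sum G Cj v'.
Hypothesis switchable : forall v (Ci : {set V}), v \in C0 -> Ci \in alpha ->
  (exists q1 q2, half_half G Ci v q1 q2) \/ gain_sum G Ci v = 0.

Let A := gain0 G.
Let A' := gain0 (switched_graph G C0 alpha).

Lemma switched_outside u v : u \in C0 -> v \in C0 -> A' u v = A u v.
Proof. by move=> uC vC; rewrite /A' gain0_switched /switched_gain uC vC. Qed.

Lemma switched_inside u v : u \notin C0 -> v \notin C0 -> A' u v = A u v.
Proof.
by move=> uC vC; rewrite /A' gain0_switched /switched_gain (negbTE uC) (negbTE vC).
Qed.

Lemma switched_from_C0 u v : u \in C0 -> v \notin C0 -> A' u v = cell_reflect (A u) v.
Proof.
move=> uC vC; rewrite /A' gain0_switched /switched_gain uC (negbTE vC).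
rewrite /cell_reflect (negbTE vC) -/(cell v) -gain_sumE; apply/eqP; rewrite -subr_eq opprK.
apply/eqP; apply/esym/cell_wtE => //; apply/esym/switch_gainD; first exact: mem_cell.
by apply: switchable => //; exact: mem_cell_alpha.
Qed.

Lemma qconj_cell_reflect f u :
  qconj (cell_reflect f u) = cell_reflect (fun w => qconj (f w)) u.
Proof.
rewrite /cell_reflect; case: ifP => // _.
by rewrite raddfB /= qconjM qconj_real quat_realC raddf_sum.
Qed.

(** This is the conjugate of [switched_from_C0]; the coefficients of the
    reflection are real. *)
Lemma switched_to_C0 u v : u \notin C0 -> v \in C0 -> A' u v = cell_reflect (A^~ v) u.
Proof.
move=> uC vC; rewrite /A' -qconj_gain0 -/A' switched_from_C0 // qconj_cell_reflect.
by congr cell_reflect; apply: funext => w; rewrite qconj_gain0.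
Qed.

(** Both sides are the sum of all gains from [cell u] to [cell v]: row sums are
    constant by regularity, column sums are conjugates of row sums from [cell v]
    to [cell u]. *)
Lemma double_count u v : u \notin C0 -> v \notin C0 ->
  gain_sum G (cell v) u *+ #|cell u| = (\sum_(w in cell u) A w v) *+ #|cell v|.
Proof.
move=> uC vC; rewrite -!sumr_const.
transitivity (\sum_(x in cell u) \sum_(y in cell v) A x y).
  apply: eq_bigr => x xu; rewrite -gain_sumE.
  by apply: regular (mem_cell_alpha uC) (mem_cell_alpha vC) _ _ _ xu; exact: mem_cell.
rewrite exchange_big; apply: eq_bigr => y yv /=.
have e z : \sum_(x in cell u) A x z = qconj (gain_sum G (cell u) z).
  by rewrite gain_sumE raddf_sum; apply: eq_bigr => x _; rewrite /= qconj_gain0.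
rewrite !e; congr qconj.
by apply: regular (mem_cell_alpha vC) (mem_cell_alpha uC) _ _ yv _; exact: mem_cell.
Qed.

(** The entrywise form of [A' K = K A].  This form needs only one reflection on
    each side, where [A' = K A K] would need two. *)
Lemma switched_intertwine u v : cell_reflect (A' u) v = cell_reflect (A^~ v) u.
Proof.
have [uC|uC] := boolP (u \in C0).
  (* The rows of [C0] in [A'] are reflected rows of [A]: reflect them back. *)
  have -> : A' u = cell_reflect (A u).
    apply: funext => w; have [wC|wC] := boolP (w \in C0); last exact: switched_from_C0.
    by rewrite switched_outside // /cell_reflect wC.
  by rewrite cell_reflectK /cell_reflect uC.
have [vC|vC] := boolP (v \in C0); first by rewrite {1}/cell_reflect vC switched_to_C0.
(* Two cells: both reflections subtract the gain from the same constant. *)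
rewrite /cell_reflect (negbTE uC) (negbTE vC) switched_inside //; congr (_ - _).
rewrite (eq_bigr (A u)) => [|w wv]; last by rewrite switched_inside // (cell_notin wv).
rewrite -gain_sumE; apply: cell_wtE => //.
rewrite -mulrnAr -(double_count uC vC); apply/esym/cell_wtE => //.
exact: mulrnAC.
Qed.

Lemma switched_reflection_conj :
  vertex_mx A' =
  vertex_mx reflection_entry *m vertex_mx A *m vertex_mx reflection_entry.
Proof.
have -> : vertex_mx reflection_entry *m vertex_mx A
        = vertex_mx A' *m vertex_mx reflection_entry.
  rewrite !vertex_mxM; apply: eq_vertex_mx => u v.
  by rewrite reflection_suml reflection_sumr switched_intertwine.
by rewrite -mulmxA reflectionK mulmx1.
Qed.

End Switching.

Theorem theorem5p9 (R : realType) (V : finType) (G : gain_graph R V)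
    (C0 : {set V}) (alpha : {set {set V}})
    (hGM : quaternionic_GM_partition G C0 alpha) :
  graph_right_cospectral G (switched_graph G C0 alpha).
Proof.
case: hGM => part regular switchable.
have KH := reflection_conj_tr R part; have KK := reflectionK R part.
have : qunitary (vertex_mx (@reflection_entry R V C0 alpha)).
  by split; rewrite qadjointE KH.
move=> /(hermitian_conj_cospectral (adjacency_hermitian G)).
by rewrite qadjointE KH -(switched_reflection_conj part regular switchable).
Qed.
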